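(* Let $(X,G)$ be a CR-dynamical system. Then the following hold. (1) $(X,G)$ is $1^{\alpha}$-minimal if and only if $(X,G)$ is $1^{\ominus}$-minimal. (2) $(X,G)$ is $2^{\alpha}$-minimal if and only if $(X,G)$ is $2^{\ominus}$-minimal. (3) If $(X,G)$ is $3^{\alpha}$-minimal, then $(X,G)$ is $3^{\ominus}$-minimal.
   Context: A CR-dynamical system is a pair $(X,G)$ where $X$ is a compact metric space and $G\subseteq X\times X$ is a non-empty closed subset. $G^{-1}=\{(y,x):(x,y)\in G\}$. Backward orbits: $\star_{i=1}^{\infty}G^{-1}=\{(x_1,x_2,x_3,\ldots)\in\prod_{i=1}^\infty X : (x_i,x_{i+1})\in G^{-1} \text{ for each positive integer } i\}$, and $\pi_k$ denotes the $k$-th coordinate projection. For $x\in X$, $T_G^{-}(x)=\{\mathbf x\in\star_{i=1}^{\infty}G^{-1} : \pi_1(\mathbf x)=x\}$. For $\mathbf x\in\star_{i=1}^{\infty}G^{-1}$, $\mathcal O_G^{\ominus}(\mathbf x)=\{\pi_k(\mathbf x): k\ge 1\}\subseteq X$. For $x\in X$, $\mathcal U_G^{\ominus}(x)=\bigcup_{\mathbf x\in T_G^{-}(x)}\mathcal O_G^{\ominus}(\mathbf x)$. $\mathrm{Cl}$ denotes closure in $X$. $(X,G)$ is $1^{\ominus}$-minimal if $T_G^{-}(x)\ne\emptyset$ for each $x\in X$ and $\mathrm{Cl}(\mathcal O_G^{\ominus}(\mathbf x))=X$ for each $\mathbf x\in\star_{i=1}^{\infty}G^{-1}$; it is $2^{\ominus}$-minimal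 if for each $x\in X$ there is $\mathbf x\in T_G^{-}(x)$ with $\mathrm{Cl}(\mathcal O_G^{\ominus}(\mathbf x))=X$; it is $3^{\ominus}$-minimal if $\mathrm{Cl}(\mathcal U_G^{\ominus}(x))=X$ for each $x\in X$. Alpha limit sets: for $\mathbf x\in\star_{i=1}^{\infty}G^{-1}$, $\alpha_G(\mathbf x)=\{x\in X : \text{there is a subsequence of the sequence } \mathbf x \text{ with limit } x\}$; for $x\in X$, $\beta_G(x)=\bigcup_{\mathbf x\in T_G^{-}(x)}\alpha_G(\mathbf x)$. $(X,G)$ is $1^{\alpha}$-minimal if $T_G^{-}(x)\neq\emptyset$ for each $x\in X$ and $\alpha_G(\mathbf x)=X$ for each $\mathbf x\in\star_{i=1}^{\infty}G^{-1}$; it is $2^{\alpha}$-minimal if for each $x\in X$ there is $\mathbf x\in T_G^{-}(x)$ with $\alpha_G(\mathbf x)=X$; it is $3^{\alpha}$-minimal if $\beta_G(x)=X$ for each $x\in X$. *)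

(* Defs.v *)
From HB Require Import structures.
From mathcomp Require Import all_boot all_order all_algebra.
From mathcomp Require Import all_classical all_reals all_analysis.

Set Implicit Arguments.
Unset Strict Implicit.
Unset Printing Implicit Defensive.

Local Open Scope classical_set_scope.

(* Sequences are indexed from 0: the k-th coordinate projection, k >= 1,
   of [u : nat -> X] is [u k.-1]. *)

Section CRDynamicalSystems.
Context {R : realType} {X : metricType R}.
Implicit Types (G : set (X * X)) (x : X) (u : nat -> X).

Definition CR_dynamical_system G : Prop :=
  [/\ compact [set: X], G !=set0 & closed G].

Definition backward_orbits G : set (nat -> X) :=
  [set u | forall i, (G^-1)%relation (u i, u i.+1)].

Definition backward_orbits_from G x : set (nat -> X) :=
  [set u | backward_orbits G u /\ u 0 = x].

Definition orbit_set u : set X := range u.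

Definition backward_reach G x : set X :=
  \bigcup_(u in backward_orbits_from G x) orbit_set u.

Definition minus_minimal1 G : Prop :=
  (forall x, backward_orbits_from G x !=set0) /\
  (forall u, backward_orbits G u -> closure (orbit_set u) = [set: X]).

Definition minus_minimal2 G : Prop :=
  forall x, exists2 u, backward_orbits_from G x u &
    closure (orbit_set u) = [set: X].

Definition minus_minimal3 G : Prop :=
  forall x, closure (backward_reach G x) = [set: X].

Definition alpha_limit u : set X :=
  [set a | exists2 phi : nat -> nat, increasing_seq phi &
    (u \o phi) n @[n --> \oo] --> a].

Definition beta_limit G x : set X :=
  \bigcup_(u in backward_orbits_from G x) alpha_limit u.

Definition alpha_minimal1 G : Prop :=
  (forall x, backward_orbits_from G x !=set0) /\
  (forall u, backward_orbits G u -> alpha_limit u = [set: X]).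

Definition alpha_minimal2 G : Prop :=
  forall x, exists2 u, backward_orbits_from G x u & alpha_limit u = [set: X].

Definition alpha_minimal3 G : Prop :=
  forall x, beta_limit G x = [set: X].

End CRDynamicalSystems.

(* Main.v *)
Require Import Defs.
From mathcomp Require Import all_boot all_order all_algebra.
From mathcomp Require Import all_classical all_reals all_analysis.

(** A limit of a subsequence of [u] is adherent to the range of [u], which gives
    every passage from alpha limits to closures of orbits. Conversely, a point
    adherent to every tail of [u] is a subsequential limit of [u].
    For (1), the tails of a backward orbit are again backward orbits. For (2), a
    dense orbit need not have dense tails, so it is replaced: follow a dense
    orbit until it meets a prescribed open ball, switch to a dense orbit
    starting at the next point, follow it until it meets the next ball, and
    so on, along a sequence of balls with radii tending to 0 whose centres run
    infinitely often through a countable dense set. *)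

Import Order.TTheory Num.Theory.
Local Open Scope classical_set_scope.
Local Open Scope ring_scope.

Section MetricSequences.
Context {R : realType} {X : metricType R}.
Implicit Types (u : nat -> X) (a : X).

Lemma alpha_limit_sub_closure u : alpha_limit u `<=` closure (orbit_set u).
Proof.
move=> a [phi _ phia] B aB; have [N _ NB] := phia _ aB.
by exists (u (phi N)); split; [exists (phi N)|exact: (NB N (leqnn N))].
Qed.

(** Recursively choosing an index past the previous one, with error below [1/(n+1)], gives the
    subsequence. *)
Lemma alpha_limit_frequently u a :
  (forall e : R, 0 < e -> forall N, exists2 n, (N <= n)%N & ball a e (u n)) ->
  alpha_limit u a.
Proof.
move=> ua.
have /choice[f fP] : forall p : nat * nat,
    exists n, (p.1 <= n)%N /\ ball a p.2.+1%:R^-1 (u n).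
  move=> [N k] /=.
  by have [|n] := ua k.+1%:R^-1 _ N; [rewrite invr_gt0 ltr0n|exists n].
pose fix phi n := if n is m.+1 then f ((phi m).+1, n) else f (0%N, 0%N).
exists phi.
  by apply/increasing_seqP => n; rewrite ltEnat /=; exact: (fP (_, _)).1.
have phi_ball n : ball a n.+1%:R^-1 (u (phi n)).
  by case: n => [|n] /=; exact: (fP (_, _)).2.
apply/cvg_ballP => e e0; near=> n; apply: le_ball (phi_ball n).
apply: ltW; near: n; exact: near_infty_natSinv_lt (PosNum e0).
Unshelve. all: by end_near.
Qed.

Lemma dense_orbit_ball u a (e : R) :
  closure (orbit_set u) = [set: X] -> 0 < e -> exists n, ball a e (u n).
Proof.
move=> ud e0; have : closure (orbit_set u) a by rewrite ud.
by move=> /(_ _ (nbhsx_ballx a e e0)) [_ [[n _ <-] aun]]; exists n.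
Qed.

End MetricSequences.

Section BackwardOrbits.
Context {R : realType} {X : metricType R}.
Variable G : set (X * X).

Lemma backward_orbits_shift (u : nat -> X) N :
  backward_orbits G u -> backward_orbits G (fun n => u (N + n)%N).
Proof. by move=> uG i; rewrite addnS; exact: uG. Qed.

(** The bound [k <= n] turns targets of large index into late visits. *)
Lemma backward_orbit_visits (U : nat -> set X) :
  (forall x, exists2 u, backward_orbits_from G x u &
    forall k, exists n, U k (u n)) ->
  forall x, exists2 u, backward_orbits_from G x u &
    forall k, exists2 n, (k <= n)%N & U k (u n).
Proof.
move=> H x.
have /choice[W WP] : forall y, exists w : nat -> X,
    backward_orbits_from G y w /\ forall k, exists n, U k (w n).
  by move=> y; have [w] := H y; exists w.
(* A state is the orbit being followed together with the index of the set to
   be met next. *)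
pose step (s : (nat -> X) * nat) :=
  if pselect (U s.2 (s.1 0%N)) then (W (s.1 1%N), s.2.+1)
  else (s.1 \o S, s.2).
pose s n := iter n step (W x, 0%N).
(* Invariant: the followed orbit meets its current target, now or later. *)
pose good (t : (nat -> X) * nat) :=
  backward_orbits G t.1 /\ exists n, U t.2 (t.1 n).
have good_step t : good t -> good (step t).
  case: t => v k [/= vG [n vn]]; rewrite /step/=.
  case: pselect => /= [?|nU]; first by split; [exact: (WP _).1.1|exact: (WP _).2].
  split => [i|]; first exact: vG.
  by case: n vn => [//|n vn]; exists n.
have sgood n : good (s n).
  elim: n => [|n]; last exact: good_step.
  by split; [exact: (WP _).1.1|exact: (WP _).2].
(* The target index grows by at most one per step, so [U k] becomes the target no earlier than time
   [k]. *)
have s_le n : ((s n).2 <= n)%N.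
  elim: n => //= n IH; rewrite /step; case: pselect => ? //=.
  exact: leqW.
(* Induction on the waiting time [m], which drops by one at each step without a switch. *)
have meet n m : U (s n).2 ((s n).1 m) ->
    exists2 n1, (s n1).2 = (s n).2 & U (s n1).2 ((s n1).1 0%N).
  elim: m n => [|m IH] n Um; first by exists n.
  case: (pselect (U (s n).2 ((s n).1 0%N))) => [U0|nU0]; first by exists n.
  have sS : s n.+1 = ((s n).1 \o S, (s n).2).
    by rewrite /s iterS -/(s n) /step; case: pselect.
  by have := IH n.+1; rewrite sS /=; exact.
have reach k : exists2 n, (s n).2 = k & U k ((s n).1 0%N).
  elim: k => [|k [n nk Un]].
    have [m /meet[n n0 Un]] := (sgood 0%N).2.
    by exists n => //; rewrite -[X in U X _]n0.
  have snS : (s n.+1).2 = k.+1.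
    by rewrite /s iterS -/(s n) /step nk; case: pselect.
  have [m /meet[n1 n1k Un1]] := (sgood n.+1).2.
  by exists n1; rewrite -snS -n1k.
(* The heads of the states form a backward orbit, since each switch restarts at the successor of the
   current head. *)
exists (fun n => (s n).1 0%N).
  split; last exact: (WP x).1.2.
  move=> i; have := (sgood i).1 0%N; rewrite /s iterS -/(s i) /step.
  by case: pselect => /= ? //; rewrite (WP _).1.2.
by move=> k; have [n <- Un] := reach k; exists n.
Qed.

Lemma dense_orbits_frequently x :
  (forall y, exists2 u, backward_orbits_from G y u &
    closure (orbit_set u) = [set: X]) ->
  exists2 u, backward_orbits_from G x u & alpha_limit u = [set: X].
Proof.
move=> H; have [c _ cd] := H x.
(* Every exponent [logn 2 k] recurs for infinitely many [k], so each centre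
   [c i] is used with arbitrarily small radii. *)
have [|u uG uU] := @backward_orbit_visits
    (fun k => ball (c (logn 2 k)) (k.+1%:R^-1 : R)) _ x.
  move=> y; have [u uG ud] := H y; exists u => // k.
  by apply: dense_orbit_ball; rewrite // invr_gt0 ltr0n.
exists u => //; apply/seteqP; split=> // a _.
apply: alpha_limit_frequently => e e0 N.
have e20 : 0 < e / 2 by rewrite divr_gt0.
have [i aci] := dense_orbit_ball _ a _ cd e20.
have [M _ Me] := near_infty_natSinv_lt (PosNum e20).
(* The factor [2 ^ i] selects the centre [c i]; the power of 3 enlarges [k] without changing
   [logn 2 k]. *)
pose k := (2 ^ i * 3 ^ (M + N))%N.
have MNk : (M + N <= k)%N.
  apply: leq_trans (ltnW (ltn_expl _ (isT : 1 < 3)%N)) _.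
  by rewrite leq_pmull // expn_gt0.
have ik : logn 2 k = i.
  by rewrite lognM ?expn_gt0 // lognX lognX !logn_prime //= muln1 muln0 addn0.
have [n kn] := uU k; rewrite ik => cun; exists n.
  by apply: leq_trans kn; apply: leq_trans MNk; rewrite leq_addl.
apply: ball_split aci _; apply: le_ball cun; apply/ltW/Me => /=.
by apply: leq_trans MNk; rewrite leq_addr.
Qed.

End BackwardOrbits.

Theorem theorem8p7 (R : realType) (X : metricType R) (G : set (X * X))
    (hG : CR_dynamical_system G) :
  [/\ alpha_minimal1 G <-> minus_minimal1 G,
      alpha_minimal2 G <-> minus_minimal2 G
    & alpha_minimal3 G -> minus_minimal3 G].
Proof.
have adense u : alpha_limit u = [set: X] -> closure (orbit_set u) = [set: X].
  by move=> ua; apply/seteqP; split=> // a _;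
    apply: alpha_limit_sub_closure; rewrite ua.
split.
- split=> -[ex H]; split=> // u uG; first exact/adense/H.
  apply/seteqP; split=> // a _; apply: alpha_limit_frequently => e e0 N.
  have ud := H _ (backward_orbits_shift _ _ N uG).
  have [n aun] := dense_orbit_ball _ a _ ud e0.
  by exists (N + n)%N => //; rewrite leq_addr.
- split=> H x; last exact: dense_orbits_frequently.
  by have [u uG ua] := H x; exists u => //; exact: adense.
- move=> H x; apply/seteqP; split=> // a _.
  have : beta_limit G x a by rewrite H.
  case=> u uG /alpha_limit_sub_closure; apply: closure_subset => y uy.
  by exists u.
Qed.
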